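(* Let $G$ be a group, let $H$ be a $G$-group, let $n$ be a positive integer, let $X=\{x_1,\dots,x_n\}$, and let $S\subseteq G[X]$ be a system of $G$-equations. If $V_H(S)=\bigcup_i K_i^n$ for some family $\{K_i\}$ of $n$-generator $G$-subgroups of $H$, then there is a variety $\mathbf{W}$ of $G$-groups such that $\Gamma_H(S)=F_{\mathbf{W}}(n)$. Conversely, if there is a variety $\mathbf{W}$ of $G$-groups such that $\Gamma_H(S)=F_{\mathbf{W}}(n)$, then $V_H(S)=\bigcup_i K_i^n$ for some family $\{K_i\}$ of $n$-generator $G$-subgroups of $H$.
   Context: A $G$-group is a group $H$ together with a homomorphism $G\to H$ (equivalently, an algebra in the language of groups with constants for the elements of $G$ that satisfies the multiplication table of $G$); a $G$-subgroup is a subgroup containing the image of $G$, and it is $n$-generator if it is generated by the image of $G$ together with some $n$ (not necessarily distinct) elements. $G[X]=G\ast F_n$ is the free product of $G$ with the free group $F_n$ on $X$. For $w\in G[X]$ and $\overline{a}=(a_1,\dots,a_n)\in H^n$, $w(\overline{a})\in H$ is the image of $w$ under the homomorphism $G[X]\to H$ that restricts to the structure map $G\to H$ and sends $x_i\mapsto a_i$. An element $w\in S$ is regarded as the equation $w=1$; $V_H(S)=\{\overline{a}\in H^n : w(\overline{a})=1\text{ for all }w\in S\}$, $\mathrm{Rad}_H(S)=\{w\in G[X] : w(\overline{a})=1\text{ for all }\overline{a}\in V_H(S)\}$, and the coordinate group is $\Gamma_H(S)=G[X]/\mathrm{Rad}_H(S)$. A variety of $G$-groups is a class of $G$-groups defined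 by a set of $G$-identities (identities $w=1$ with $w$ a group word with coefficients from $G$). For such a variety $\mathbf{W}$, the $n$-generator relatively free group is $F_{\mathbf{W}}(n)=G[X]/I$, where $I\subseteq G[X]$ is the set of all $w\in G[X]$ such that $w=1$ is a $G$-identity valid in every member of $\mathbf{W}$. The equality $\Gamma_H(S)=F_{\mathbf{W}}(n)$ is equality as quotients of $G[X]$, i.e. $\mathrm{Rad}_H(S)=I$. Families may be empty. *)

(* Defs.v *)
From HB Require Import structures.
From mathcomp Require Import all_boot.
From mathcomp Require Import boolp classical_sets.

Set Implicit Arguments.
Unset Strict Implicit.
Unset Printing Implicit Defensive.

Import Algebra.

Local Open Scope quotient_scope.
Local Open Scope classical_set_scope.
Local Open Scope group_scope.

(* Every type can be made a [choiceType] classically, so [groupType] covers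
   arbitrary groups.  [UMagmaMorphism.type] between two [groupType]s is the
   type of group homomorphisms. *)
Notation "{ 'ghom' G -> H }" := (UMagmaMorphism.type G H)
  (at level 0, G at level 98, H at level 99,
   format "{ 'ghom'  G  ->  H }") : type_scope.

(** The free product of [G] with the free group on [X], as the quotient of the
    monoid of words by the congruence generated by the multiplication table of
    [G] and the cancellation of formal inverses.  The letter [inr (x, b)] stands
    for [x] if [b] is true and for [x^-1] otherwise. *)
Section FreeProduct.
Variables (G : groupType) (X : choiceType).

Definition letter : Type := (G + X * bool)%type.

Definition word : Type := seq letter.

Inductive word_cong : word -> word -> Prop :=
| word_cong_refl u : word_cong u u
| word_cong_sym u v : word_cong u v -> word_cong v u
| word_cong_trans u v w : word_cong u v -> word_cong v w -> word_cong u w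
| word_cong_cat u u' v v' :
    word_cong u u' -> word_cong v v' -> word_cong (u ++ v) (u' ++ v')
| word_cong_one : word_cong [:: inl 1] [::]
| word_cong_mul g h : word_cong [:: inl g; inl h] [:: inl (g * h)]
| word_cong_var x b : word_cong [:: inr (x, b); inr (x, ~~ b)] [::].

Definition word_eqb (u v : word) : bool := `[< word_cong u v >].

Fact word_eqb_refl : reflexive word_eqb.
Proof. by move=> u; apply/asboolP; apply: word_cong_refl. Qed.

Fact word_eqb_sym : symmetric word_eqb.
Proof. by move=> u v; apply/asboolP/asboolP; apply: word_cong_sym. Qed.

Fact word_eqb_trans : transitive word_eqb.
Proof.
by move=> v u w /asboolP uv /asboolP vw; apply/asboolP/(word_cong_trans uv vw).
Qed.

Canonical word_equiv := EquivRel word_eqb word_eqb_refl word_eqb_sym word_eqb_trans.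

Definition free_prod : Type := {eq_quot word_equiv}.
HB.instance Definition _ := Choice.copy free_prod {eq_quot word_equiv}.
HB.instance Definition _ := EqQuotient.copy free_prod {eq_quot word_equiv}.

Lemma free_prodP (u v : word) :
  \pi_free_prod u = \pi_free_prod v <-> word_cong u v.
Proof.
by split=> [/eqmodP /asboolP|uv]; last by apply/eqmodP/asboolP.
Qed.

Definition inv_letter (l : letter) : letter :=
  match l with inl g => inl g^-1 | inr (x, b) => inr (x, ~~ b) end.

Definition inv_word (u : word) : word := rev (map inv_letter u).

Lemma inv_letterK : involutive inv_letter.
Proof. by case=> [g|[x b]] /=; rewrite ?invgK ?negbK. Qed.

Lemma inv_wordK : involutive inv_word.
Proof. by move=> u; rewrite /inv_word map_rev revK (mapK inv_letterK). Qed.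

Lemma letter_mulV l : word_cong [:: l; inv_letter l] [::].
Proof.
case: l => [g|[x b]] /=; last exact: word_cong_var.
apply: word_cong_trans (word_cong_mul _ _) _.
by rewrite mulgV; apply: word_cong_one.
Qed.

Lemma word_mulV u : word_cong (u ++ inv_word u) [::].
Proof.
elim: u => [|l u IHu]; first exact: word_cong_refl.
have -> : (l :: u) ++ inv_word (l :: u) =
    [:: l] ++ ((u ++ inv_word u) ++ [:: inv_letter l]).
  by rewrite /inv_word /= rev_cons -cats1 catA.
apply: word_cong_trans (letter_mulV l).
apply: (@word_cong_cat [:: l] [:: l]); first exact: word_cong_refl.
exact: (@word_cong_cat _ [::] _ [:: _] IHu (word_cong_refl _)).
Qed.

Lemma word_mulVl u : word_cong (inv_word u ++ u) [::].
Proof. by have := word_mulV (inv_word u); rewrite inv_wordK. Qed.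

Lemma inv_word_cong u v : word_cong u v -> word_cong (inv_word u) (inv_word v).
Proof.
move=> uv; apply: word_cong_trans (_ : word_cong (inv_word u ++ (v ++ inv_word v)) _).
  rewrite -[X in word_cong X]cats0; apply: word_cong_cat (word_cong_refl _) _.
  exact/word_cong_sym/word_mulV.
rewrite catA -[X in word_cong _ X]cat0s.
apply: word_cong_cat; last exact: word_cong_refl.
apply: word_cong_trans (word_mulVl u).
by apply: word_cong_cat; [apply: word_cong_refl | apply: word_cong_sym].
Qed.

Definition fp_one : free_prod := \pi_free_prod [::].
Definition fp_mul (a b : free_prod) : free_prod := \pi_free_prod (repr a ++ repr b).
Definition fp_inv (a : free_prod) : free_prod := \pi_free_prod (inv_word (repr a)).

Lemma fp_mulE u v : fp_mul (\pi u) (\pi v) = \pi_free_prod (u ++ v).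
Proof. by apply/free_prodP/word_cong_cat; apply/free_prodP; rewrite reprK. Qed.

Lemma fp_invE u : fp_inv (\pi u) = \pi_free_prod (inv_word u).
Proof. by apply/free_prodP/inv_word_cong/free_prodP; rewrite reprK. Qed.

Fact fp_mulA : associative fp_mul.
Proof.
by elim/quotW=> u; elim/quotW=> v; elim/quotW=> w; rewrite !fp_mulE catA.
Qed.

Fact fp_mul1 : left_id fp_one fp_mul.
Proof. by elim/quotW=> u; rewrite fp_mulE. Qed.

Fact fp_mulr1 : right_id fp_one fp_mul.
Proof. by elim/quotW=> u; rewrite fp_mulE cats0. Qed.

Fact fp_mulV : left_inverse fp_one fp_inv fp_mul.
Proof.
by elim/quotW=> u; rewrite fp_invE fp_mulE; apply/free_prodP/word_mulVl.
Qed.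

Fact fp_mulVr : right_inverse fp_one fp_inv fp_mul.
Proof.
by elim/quotW=> u; rewrite fp_invE fp_mulE; apply/free_prodP/word_mulV.
Qed.

HB.instance Definition _ :=
  isGroup.Build free_prod fp_mulA fp_mul1 fp_mulr1 fp_mulV fp_mulVr.

Lemma free_prod_mulE u v :
  \pi_free_prod u * \pi_free_prod v = \pi_free_prod (u ++ v).
Proof. exact: fp_mulE. Qed.

Definition fp_cst (g : G) : free_prod := \pi_free_prod [:: inl g].
Definition fp_var (x : X) : free_prod := \pi_free_prod [:: inr (x, true)].

Fact fp_cst_morph : monoid_morphism fp_cst.
Proof.
split=> [|g h]; first exact/free_prodP/word_cong_one.
by rewrite free_prod_mulE; apply/free_prodP/word_cong_sym/word_cong_mul.
Qed.

HB.instance Definition _ := isUMagmaMorphism.Build G free_prod fp_cst fp_cst_morph.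

End FreeProduct.

Notation "G '*F' X" := (free_prod G X) (at level 40, left associativity) : type_scope.

Record Ggroup (G : groupType) : Type := GGroup {
  Ggroup_sort :> groupType;
  Ggroup_map : {ghom G -> Ggroup_sort}
}.

(** The homomorphism [G *F X -> H] which restricts to the structure map on [G]
    and sends [x] to [a x]. *)
Section Evaluation.
Variables (G : groupType) (X : choiceType) (H : Ggroup G) (a : X -> H).

Definition eval_letter (l : letter G X) : H :=
  match l with
  | inl g => Ggroup_map H g
  | inr (x, b) => if b then a x else (a x)^-1
  end.

Definition eval_word (u : word G X) : H := \prod_(l <- u) eval_letter l.

Definition eval (w : G *F X) : H := eval_word (repr w).

Lemma eval_word_cong u v : word_cong u v -> eval_word u = eval_word v.
Proof.
rewrite /eval_word; elim=> {u v} [//|u v _ ->//|u v w _ -> _ ->//|||g h|x b].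
- by move=> u u' v v' _ uu' _ vv'; rewrite !big_cat uu' vv'.
- by rewrite big_seq1 big_nil /= gmulf1.
- by rewrite big_cons !big_seq1 /= gmulfM.
- by rewrite big_cons big_seq1 big_nil; case: b => /=; rewrite ?mulgV ?mulVg.
Qed.

Lemma eval_pi u : eval (\pi u) = eval_word u.
Proof. by apply/eval_word_cong/free_prodP; rewrite reprK. Qed.

Fact eval_morph : monoid_morphism eval.
Proof.
split=> [|]; first by rewrite eval_pi /eval_word big_nil.
elim/quotW=> u; elim/quotW=> v.
by rewrite free_prod_mulE !eval_pi /eval_word big_cat.
Qed.

HB.instance Definition _ := isUMagmaMorphism.Build (G *F X) H eval eval_morph.

Lemma eval1 : eval 1 = 1. Proof. exact: gmulf1. Qed.
Lemma evalF u v : eval (u / v) = eval u / eval v. Proof. exact: gmulfF. Qed.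
Lemma evalJ u v : eval (u ^ v) = eval u ^ eval v. Proof. exact: gmulfJ. Qed.

Lemma eval_cst g : eval (fp_cst X g) = Ggroup_map H g.
Proof. by rewrite eval_pi /eval_word big_seq1. Qed.

Lemma eval_var x : eval (fp_var G x) = a x.
Proof. by rewrite eval_pi /eval_word big_seq1. Qed.

Lemma eval_unique (f : {ghom G *F X -> H}) :
    (forall g, f (fp_cst X g) = Ggroup_map H g) ->
    (forall x, f (fp_var G x) = a x) ->
  f =1 eval.
Proof.
move=> fG fX; elim/quotW; elim=> [|l u IHu].
  by rewrite -[\pi _]/(1 : G *F X) !gmulf1.
rewrite -cat1s -free_prod_mulE !gmulfM IHu; congr (_ * _).
case: l => [g|[x []]]; first by rewrite -[\pi _]/(fp_cst X g) fG [RHS]eval_cst.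
  by rewrite -[\pi _]/(fp_var G x) fX [RHS]eval_var.
have -> : \pi_(G *F X) [:: inr (x, false)] = (fp_var G x)^-1.
  by rewrite [RHS]fp_invE.
by rewrite !gmulfV fX; congr (_^-1); rewrite [RHS]eval_var.
Qed.

End Evaluation.

Section Gsubgroups.
Variables (G : groupType) (H : Ggroup G).

Definition Gsubgroup (K : set H) : Prop :=
  group_closed [in K] /\ range (Ggroup_map H) `<=` K.

Definition generated (A : set H) : set H :=
  smallest (fun K : set H => group_closed [in K]) A.

Definition generator_Gsubgroup (n : nat) (K : set H) : Prop :=
  Gsubgroup K /\
  exists b : 'I_n -> H, K = generated (range (Ggroup_map H) `|` range b).

Definition set_power (n : nat) (K : set H) : set ('I_n -> H) :=
  [set a | forall i, K (a i)].

End Gsubgroups.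

Arguments set_power {G H} n K _.
Arguments generator_Gsubgroup {G H} n K.

Section AlgebraicSets.
Variables (G : groupType) (H : Ggroup G) (n : nat) (S : set (G *F 'I_n)).

Definition solutions : set ('I_n -> H) :=
  [set a | forall w, S w -> eval a w = 1].

Definition Rad : set (G *F 'I_n) :=
  [set w | forall a, solutions a -> eval a w = 1].

End AlgebraicSets.

Arguments solutions {G} H {n} S _.
Arguments Rad {G} H {n} S _.

Definition Gidentity (G : groupType) (X : choiceType) (w : G *F X)
    (H : Ggroup G) : Prop :=
  forall a : X -> H, eval a w = 1.

(* A single identity involves finitely many variables, so countably many
   variables are enough to express every set of identities. *)
Definition is_variety (G : groupType) (W : Ggroup G -> Prop) : Prop :=
  exists E : set (G *F nat), forall H, W H <-> forall w, E w -> Gidentity w H.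

Definition identities (G : groupType) (W : Ggroup G -> Prop) (n : nat) :
    set (G *F 'I_n) :=
  [set w | forall H, W H -> Gidentity w H].
Arguments identities {G} W n _.

(** The quotient of a group by a normal subgroup [N] is its set of cosets. *)
Section Quotients.
Variable F : groupType.

Definition is_normal (N : set F) : Prop :=
  group_closed [in N] /\ forall x y, N x -> N (x ^ y).

Definition coset (N : set F) (x : F) : set F := [set x * y | y in N].

Definition quotient (N : set F) : set (set F) := range (coset N).

Lemma quotient_inj (N M : set F) :
  is_normal N -> is_normal M -> quotient N = quotient M <-> N = M.
Proof.
move=> nN nM; split=> [|->//].
have sub (A B : set F) : is_normal A -> is_normal B ->
    quotient A = quotient B -> A `<=` B.
  move=> [[/set_mem A1 _] _] [[B1 Bdiv] _] qAB.
  have [x _ xBA] : quotient B A.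
    by rewrite -qAB; exists 1 => //; apply/seteqP; split=> [_ [y Ay <-]|y Ay];
      rewrite ?mul1g //; exists y; rewrite ?mul1g.
  move: A1; rewrite -xBA => -[y By xy1] _ [z Bz <-].
  have BV u : B u -> B u^-1.
    by move=> /mem_set Bu; rewrite -div1g; apply/set_mem/(Bdiv _ _ B1).
  have -> : x = y^-1 by rewrite -div1g -xy1 mulgK.
  rewrite -[z]invgK; apply/set_mem/Bdiv; apply/mem_set; first exact: BV.
  exact: BV.
by move=> qNM; apply/seteqP; split; apply: sub.
Qed.

End Quotients.

Lemma Rad_normal (G : groupType) (H : Ggroup G) (n : nat) (S : set (G *F 'I_n)) :
  is_normal (Rad H S).
Proof.
split=> [|u v uR a Va]; last by rewrite evalJ uR // conj1g.
split=> [|u v /set_mem uR /set_mem vR]; apply/mem_set => a Va.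
  exact: eval1.
by rewrite evalF uR // vR // divgg.
Qed.

Lemma identities_normal (G : groupType) (W : Ggroup G -> Prop) (n : nat) :
  is_normal (identities W n).
Proof.
split=> [|u v uI H WH a]; last by rewrite evalJ uI // conj1g.
split=> [|u v /set_mem uI /set_mem vI]; apply/mem_set => H WH a.
  exact: eval1.
by rewrite evalF uI // vI // divgg.
Qed.

Definition coordinate_group (G : groupType) (H : Ggroup G) (n : nat)
    (S : set (G *F 'I_n)) : set (set (G *F 'I_n)) :=
  quotient (Rad H S).
Arguments coordinate_group {G} H {n} S _.

Definition relatively_free (G : groupType) (W : Ggroup G -> Prop) (n : nat) :
    set (set (G *F 'I_n)) :=
  quotient (identities W n).
Arguments relatively_free {G} W n _.

(* Main.v *)
Require Import Defs.
From HB Require Import structures.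
From mathcomp Require Import all_boot.
From mathcomp Require Import boolp classical_sets.

Set Implicit Arguments.
Unset Strict Implicit.
Unset Printing Implicit Defensive.

Local Open Scope classical_set_scope.

(** Both conditions say that the set [V] of solutions contains the whole power
    [K_a ^ n] of the [G]-subgroup [K_a] generated by the image of [G] and the
    coordinates of [a], for every [a] in [V].  Since [K_a] consists of the values
    [w(a)], this means that [Rad_H(S)] is stable under the endomorphisms of [G[X]]
    that fix [G], which holds for the identities of a class of [G]-groups.
    Conversely, the elements of [Rad_H(S)] taken as identities define a variety
    which contains every such [K_a], so that any identity of the variety holds
    at every [a] in [V]. *)

Import Algebra.
Local Open Scope group_scope.

Section SubGgroup.
Variables (G : groupType) (H : Ggroup G) (K : set H) (KP : Gsubgroup K).

(** The proof [KP] is an argument of the type so that the group structure attached to it can draw on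
    the closure of [K]. *)
Definition Gsubgroup_type of Gsubgroup K : Type := {x : H | x \in K}.
Local Notation T := (Gsubgroup_type KP).

HB.instance Definition _ := SubChoice.copy T {x : H | x \in K}.
HB.instance Definition _ :=
  SubChoice_isSubGroup.Build H [in K] T KP.1.

Definition Gsubgroup_map (g : G) : T :=
  exist _ (Ggroup_map H g) (mem_set (KP.2 _ (imageT (Ggroup_map H) g))).

Fact Gsubgroup_map_morph : monoid_morphism Gsubgroup_map.
Proof.
split=> [|g h]; apply: val_inj; first by rewrite [RHS]gmulf1 /= gmulf1.
by rewrite [RHS]gmulfM /= gmulfM.
Qed.

HB.instance Definition _ :=
  isUMagmaMorphism.Build G T Gsubgroup_map Gsubgroup_map_morph.

Definition Gsubgroup_Ggroup : Ggroup G := GGroup (Gsubgroup_map : {ghom G -> T}).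

End SubGgroup.

(** With this structure, substituting words for variables is itself an evaluation. *)
Definition free_Ggroup (G : groupType) (X : choiceType) : Ggroup G :=
  GGroup (@fp_cst G X : {ghom G -> G *F X}).

Lemma eval_ghom (G : groupType) (X : choiceType) (M N : Ggroup G)
    (f : {ghom M -> N}) (a : X -> M) (w : G *F X) :
  (forall g, f (Ggroup_map M g) = Ggroup_map N g) ->
  f (eval a w) = eval (f \o a) w.
Proof.
move=> fG; rewrite /eval /eval_word.
rewrite (big_morph f gmulfM gmulf1); apply: eq_bigr => -[g|[x b]] _ //=.
by case: b; rewrite ?gmulfV.
Qed.

Lemma val_eval (G : groupType) (X : choiceType) (H : Ggroup G) (K : set H)
    (KP : Gsubgroup K) (b : X -> Gsubgroup_Ggroup KP) (w : G *F X) :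
  val (eval b w) = eval (fun x => val (b x)) w.
Proof.
pose f : {ghom Gsubgroup_type KP -> H} := val.
exact: (@eval_ghom _ _ (Gsubgroup_Ggroup KP) H f).
Qed.

(** Evaluation at [a] is a homomorphism fixing the constants from [G], so it can serve as [f] in
    [eval_ghom]. *)
Lemma eval_subst (G : groupType) (X Y : choiceType) (H : Ggroup G) (a : Y -> H)
    (v : X -> free_Ggroup G Y) (w : G *F X) :
  eval a (eval v w) = eval (fun x => eval a (v x)) w.
Proof.
exact: (@eval_ghom _ _ (free_Ggroup G Y) H (eval a) v w (@eval_cst _ _ _ a)).
Qed.

Section GeneratedByPoint.
Variables (G : groupType) (H : Ggroup G) (n : nat) (a : 'I_n -> H).

Lemma eval_Gsubgroup (K : set H) (w : G *F 'I_n) :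
  Gsubgroup K -> set_power n K a -> K (eval a w).
Proof.
move=> KP Ka.
(* Evaluating inside [K], seen as a G-group, replaces an induction on words. *)
pose b i : Gsubgroup_Ggroup KP := exist _ (a i) (mem_set (Ka i)).
have <- : val (eval b w) = eval a w by rewrite val_eval.
exact/set_mem/valP.
Qed.

Lemma range_eval_Gsubgroup : Gsubgroup (range (eval a)).
Proof.
split; last by move=> _ [g _ <-]; exists (fp_cst _ g) => //; exact: eval_cst.
split; first by apply/mem_set; exists 1 => //; exact: eval1.
move=> _ _ /set_mem[u _ <-] /set_mem[v _ <-].
by apply/mem_set; exists (u / v) => //; exact: evalF.
Qed.

Lemma range_eval_point : set_power n (range (eval a)) a.
Proof. by move=> i; exists (fp_var _ i) => //; exact: eval_var. Qed.

Lemma range_eval_generator : generator_Gsubgroup n (range (eval a)).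
Proof.
split; first exact: range_eval_Gsubgroup.
exists a; apply/seteqP; split.
  move=> _ [w _ <-] K [/= KC GaK].
  apply: eval_Gsubgroup; last by move=> i; apply: GaK; right; exists i.
  by split=> // h Gh; apply: GaK; left.
apply: smallest_sub; first exact: range_eval_Gsubgroup.1.
move=> h [|[i _ <-]]; first exact: range_eval_Gsubgroup.2.
exact: range_eval_point.
Qed.

End GeneratedByPoint.

Section Closure.
Variables (G : groupType) (H : Ggroup G) (n : nat) (S : set (G *F 'I_n)).

Lemma solutions_cover_closed :
  (exists (I : Type) (K : I -> set H),
     (forall i, generator_Gsubgroup n (K i)) /\
     solutions H S = \bigcup_i set_power n (K i)) <->
  (forall a, solutions H S a ->
     set_power n (range (eval a)) `<=` solutions H S).
Proof.
split=> [[I [K [KP VK]]] a|Vcl].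
  rewrite VK => -[i _ Kia] b ab; exists i => // j.
  by have [w _ <-] := ab j; apply: eval_Gsubgroup => //; have [] := KP i.
(* The family is indexed by the solutions themselves, each lying in the power of the subgroup it
   generates; it is empty when there are none. *)
exists {a | solutions H S a}, (fun a => range (eval (sval a))).
split=> [a|]; first exact: range_eval_generator.
apply/seteqP; split=> [a Va|b [[a Va] _ /= ab]]; last exact: Vcl ab.
by exists (exist _ a Va) => //; exact: range_eval_point.
Qed.

Lemma sub_Rad : S `<=` Rad H S.
Proof. by move=> w Sw a; exact. Qed.

Lemma identities_subst (W : Ggroup G -> Prop) (v : 'I_n -> free_Ggroup G 'I_n)
    (w : G *F 'I_n) :
  identities W n w -> identities W n (eval v w).
Proof. by move=> wI M WM a; rewrite eval_subst; exact: wI. Qed.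

Lemma identities_solutions_closed (W : Ggroup G -> Prop) :
    Rad H S = identities W n ->
  forall a, solutions H S a -> set_power n (range (eval a)) `<=` solutions H S.
Proof.
move=> RI a Va b ab w Sw.
(* Choose words with [b i = v_i(a)]: then [w(b)] is the value at [a] of [w] with each [v_i]
   substituted for the i-th variable. *)
pose v i : free_Ggroup G 'I_n := s2val (cid2 (ab i)).
have -> : b = (fun i => eval a (v i)).
  by apply/funext => i; rewrite /v; case: cid2.
rewrite -eval_subst.
have Rvw : Rad H S (eval v w).
  by rewrite RI; apply: identities_subst; rewrite -RI; exact: sub_Rad.
exact: Rvw.
Qed.

End Closure.

Definition satisfies (G : groupType) (X : choiceType) (R : set (G *F X))
    (M : Ggroup G) : Prop :=
  forall w, R w -> Gidentity w M.

(** Renaming the i-th variable to the natural number i turns [R] into identities over [nat]. *)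
Lemma satisfies_variety (G : groupType) (n : nat) (R : set (G *F 'I_n)) :
  is_variety (satisfies R).
Proof.
pose v (i : 'I_n) : free_Ggroup G nat := fp_var G (val i).
have vE (M : Ggroup G) (a : nat -> M) w :
    eval a (eval v w) = eval (a \o val) w.
  by rewrite eval_subst; congr (eval _ w); apply/funext => i; exact: eval_var.
exists (eval v @` R) => M; split=> [RM _ [w Rw <-] a|RM w Rw a].
  by rewrite vE; exact: RM.
(* Extend [a] by the default value 1 to indices from [n] on; the renamed words only involve indices
   below [n]. *)
pose a' k := if insub k is Some i then a i else 1.
have -> : a = a' \o val by apply/funext => i; rewrite /a' /= valK.
by rewrite -vE; apply: RM; exists w.
Qed.

Lemma Rad_identities (G : groupType) (H : Ggroup G) (n : nat)
    (S : set (G *F 'I_n)) :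
    (forall a, solutions H S a ->
       set_power n (range (eval a)) `<=` solutions H S) ->
  Rad H S = identities (satisfies (Rad H S)) n.
Proof.
move=> Vcl; apply/seteqP; split=> [w Rw M|w wI a Va]; first exact.
have KP := range_eval_Gsubgroup a.
(* A tuple [b] in the subgroup generated by [a] is a solution by [Vcl], so every element of the
   radical vanishes on it. *)
have KW : satisfies (Rad H S) (Gsubgroup_Ggroup KP).
  move=> u Ru b; apply: val_inj; rewrite val_eval [RHS]gmulf1.
  by apply: Ru; apply: Vcl Va _ _ => i; exact/set_mem/valP.
(* The identity [w] is now tested at the point [a] itself, viewed inside that subgroup. *)
pose b i : Gsubgroup_Ggroup KP := exist _ (a i) (mem_set (range_eval_point a i)).
by have := congr1 val (wI _ KW b); rewrite val_eval [RHS]gmulf1.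
Qed.

Theorem corollary3 (G : groupType) (H : Ggroup G) (n : nat) (n_gt0 : (0 < n)%N)
    (S : set (G *F 'I_n)) :
  (exists (I : Type) (K : I -> set H),
     (forall i, generator_Gsubgroup n (K i)) /\
     solutions H S = \bigcup_i set_power n (K i))
  <->
  (exists W : Ggroup G -> Prop,
     is_variety W /\ coordinate_group H S = relatively_free W n).
Proof.
rewrite solutions_cover_closed; split=> [Vcl|[W [_ quo]]].
  exists (satisfies (Rad H S)); split; first exact: satisfies_variety.
  by rewrite /coordinate_group /relatively_free -Rad_identities.
apply: (@identities_solutions_closed _ _ _ _ W).
exact: (quotient_inj (Rad_normal H S) (identities_normal W n)).1 quo.
Qed.
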